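(* Let $R$ be a Noetherian ring, $M$ a finitely generated $R$-module and $I_1,\dots,I_t$ ideals of $R$. Then there exists $k\in\mathbb N$ such that for all $n_1,\dots,n_t\in\mathbb N$ and all ideals $J\subseteq R$, \[ J^{k|\underline n|}M\cap\big(I_1^{n_1}\cdots I_t^{n_t}M:_M J^{\infty}\big)\subseteq I_1^{n_1}\cdots I_t^{n_t}M, \] equivalently \[ I_1^{n_1}\cdots I_t^{n_t}M=\big(J^{k|\underline n|}M+I_1^{n_1}\cdots I_t^{n_t}M\big)\cap\big(I_1^{n_1}\cdots I_t^{n_t}M:_M J^{\infty}\big), \] where $|\underline n|=n_1+\cdots+n_t$.
   Context: $\mathbb N=\{0,1,2,\dots\}$, with $I^0=R$. For a submodule $N\subseteq M$ and an ideal $J$, $(N:_M J^{\infty})=\bigcup_{i\ge 0}(N:_M J^i)$, where $(N:_M J^i)=\{x\in M: J^i x\subseteq N\}$. *)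

(* Defs.v *)
From HB Require Import structures.
From mathcomp Require Import all_boot all_order all_algebra.
Set Implicit Arguments. Unset Strict Implicit. Unset Printing Implicit Defensive.
Import GRing.Theory.
Local Open Scope ring_scope.

Section Defs.
Variable R : comPzRingType.

Definition is_ideal (I : R -> Prop) : Prop :=
  [/\ I 0, (forall x y, I x -> I y -> I (x + y)) & (forall r x, I x -> I (r * x))].

Definition noetherian : Prop :=
  forall F : nat -> R -> Prop, (forall n, is_ideal (F n)) ->
    (forall n x, F n x -> F n.+1 x) ->
    exists N, forall n, (N <= n)%N -> forall x, F n x -> F N x.

Definition idealMul (I J : R -> Prop) : R -> Prop :=
  fun x => exists m (a b : 'I_m -> R),
    (forall i, I (a i) /\ J (b i)) /\ x = \sum_(i < m) a i * b i.

Definition idealX (I : R -> Prop) (n : nat) : R -> Prop :=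
  iter n (idealMul I) (fun _ => True).

Definition idealProdPow (t : nat) (I : 'I_t -> R -> Prop) (n : 'I_t -> nat)
  : R -> Prop :=
  foldr (fun i acc => idealMul (idealX (I i) (n i)) acc) (fun _ => True)
        (enum 'I_t).

Variable M : lmodType R.

Definition fin_gen : Prop :=
  exists m (v : 'I_m -> M), forall x : M,
    exists c : 'I_m -> R, x = \sum_(i < m) c i *: v i.

Definition modMul (I : R -> Prop) : M -> Prop :=
  fun x => exists m (a : 'I_m -> R) (v : 'I_m -> M),
    (forall i, I (a i)) /\ x = \sum_(i < m) a i *: v i.

Definition colon (N : M -> Prop) (J : R -> Prop) (i : nat) : M -> Prop :=
  fun x => forall a, idealX J i a -> N (a *: x).

Definition colon_inf (N : M -> Prop) (J : R -> Prop) : M -> Prop :=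
  fun x => exists i : nat, colon N J i x.

End Defs.

(* Main.v *)
Require Import Defs.
From HB Require Import structures.
From mathcomp Require Import all_boot all_order all_algebra.
From mathcomp Require Import boolp.
Import GRing.Theory.
Local Open Scope ring_scope.

(** Write [I^n M] for [I_1^{n_1} ... I_t^{n_t} M] and [e_i] for the unit vectors.
    The multigraded Rees module with components [I^n M] is Noetherian.  For a
    fixed ideal [P] the Artin-Rees argument then gives a [k] such that
    [P^(l+k) I^n M] meets the saturation [(I^(n+e_i) M : P^oo)] inside
    [P^l I^(n+e_i) M] for all [l], [n], [i]; climbing from [0] to [n] in unit
    steps, an element of [P^(k|n|) M] which a power of [P] multiplies into
    [I^n M] lies in [I^n M].  The constant is made independent of [P] because
    only finitely many primes are associated to the modules
    [I^n M / I^(n+e_i) M].  If [x] violates the theorem for [J], some multiple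
    [r x] has a prime annihilator [P] modulo [I^n M]; then [P] contains [J], it
    is associated to some [I^m M / I^(m+e_i) M], and [r x] violates the
    statement for [P].

    Graded submodules are families [N : D -> M -> Prop] of submodules of the
    single module [M], stable under operators [(a, s)]: multiplication by [a]
    maps the component of degree [d] to the one of degree [s d]. *)

Set Implicit Arguments.
Unset Strict Implicit.

(** * Ascending chains and maximal elements *)

Lemma chain_le (T : Type) (F : nat -> T -> Prop) :
  (forall n x, F n x -> F n.+1 x) ->
  forall m n, (m <= n)%N -> forall x, F m x -> F n x.
Proof.
move=> Fi m n /subnK <- x Fx; elim: (n - m)%N => // k IH; exact: Fi.
Qed.

(** Without a maximal [A], repeatedly choosing a strictly larger member yields a chain in [Q] that
    never becomes stationary. *)
Lemma acc_max (T : Type) (good : (T -> Prop) -> Prop) :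
  (forall F : nat -> T -> Prop, (forall n, good (F n)) ->
     (forall n x, F n x -> F n.+1 x) ->
     exists N, forall n, (N <= n)%N -> forall x, F n x -> F N x) ->
  forall Q : (T -> Prop) -> Prop, (forall A, Q A -> good A) ->
  (exists A, Q A) ->
  exists2 A, Q A & forall B, Q B -> (forall x, A x -> B x) ->
    forall x, B x -> A x.
Proof.
move=> acc Q Qgood [A0 QA0]; apply: contrapT => nomax.
have next (A : {A | Q A}) : exists B : {B | Q B},
    (forall x, sval A x -> sval B x) /\ ~ (forall x, sval B x -> sval A x).
  case: A => A QA /=; apply: contrapT => noB; apply: nomax; exists A => // B QB AB.
  apply: contrapT => nBA; apply: noB; by exists (exist _ B QB).
have [f fP] := choice next.
pose F n := sval (iter n f (exist _ A0 QA0)).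
have [||N FN] := acc F.
- by move=> n; apply: Qgood; exact: svalP.
- by move=> n; exact: (fP _).1.
- by apply: (fP (iter N f (exist _ A0 QA0))).2; exact: (FN N.+1).
Qed.

(** * Noetherian modules *)

Section Submodules.
Variables (R : comPzRingType) (M : lmodType R).
Hypothesis noethR : noetherian R.

Definition submod (N : M -> Prop) : Prop :=
  [/\ N 0, (forall x y, N x -> N y -> N (x + y)) & (forall r x, N x -> N (r *: x))].

Lemma submodB N x y : submod N -> N x -> N y -> N (x - y).
Proof. by case=> _ ND NZ Nx Ny; apply: ND => //; rewrite -scaleN1r; apply: NZ. Qed.

Lemma is_ideal_transporter (N : M -> Prop) (x : M) :
  submod N -> is_ideal (fun r => N (r *: x)).
Proof.
case=> N0 ND NZ; split=> [|r s ? ?|r s ?].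
- by rewrite scale0r.
- by rewrite scalerDl; apply: ND.
- by rewrite -scalerA; apply: NZ.
Qed.

(** A maximal finitely generated ideal inside [I] absorbs every element of [I]. Generation by [s] is
    expressed by minimality among ideals, which spares linear combinations. *)
Lemma ideal_fg (I : R -> Prop) : is_ideal I ->
  exists2 s : seq R, (forall a, a \in s -> I a) &
    forall N, is_ideal N -> (forall a, a \in s -> N a) -> forall a, I a -> N a.
Proof.
move=> idI.
pose gens (s : seq R) a := forall N, is_ideal N -> (forall b, b \in s -> N b) -> N a.
pose Q A := exists2 s : seq R, (forall a, a \in s -> I a) & A = gens s.
have [|| A [s sI ->] smax] := @acc_max R (@is_ideal R) noethR Q.
- move=> _ [s sI ->]; split=> [N [N0 _ _] _ //|x y Hx Hy N idN sN|r x Hx N idN sN].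
  + by case: (idN) => _ ND _; apply: ND; [apply: Hx | apply: Hy].
  + by case: (idN) => _ _ NM; apply: NM; apply: Hx.
- by exists (gens [::]), [::].
exists s => // N idN sN a Ia.
apply: (smax (gens (a :: s))) => //.
- exists (a :: s) => // b; rewrite inE => /orP[/eqP->//|]; exact: sI.
- by move=> x Hx N' idN' sN'; apply: Hx => // b bs; apply: sN'; rewrite inE bs orbT.
- by move=> N' _; apply; rewrite inE eqxx.
Qed.

(** Chains are confined to [V], so that generators of [M] can be adjoined one by one without types
    of submodules or quotients. *)
Definition acc_submod (V : M -> Prop) : Prop :=
  forall F : nat -> M -> Prop, (forall n, submod (F n)) ->
    (forall n x, F n x -> V x) -> (forall n x, F n x -> F n.+1 x) ->
    exists N, forall n, (N <= n)%N -> forall x, F n x -> F N x.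

(** Two chains control [F]: the intersections with [V], and the ideals of coefficients at [v]. Once
    both are stationary, so is [F]. *)
Lemma acc_submod_adjoin (V : M -> Prop) (v : M) : submod V -> acc_submod V ->
  acc_submod (fun x => exists r y, V y /\ x = r *: v + y).
Proof.
move=> sV accV F sF FV Fi.
have [||| N1 FN1] := accV (fun n x => F n x /\ V x).
- move=> n; case: (sF n) (sV) => F0 FD FZ [V0 VD VZ].
  by split=> // [x y [? ?] [? ?]|r x [? ?]]; split; auto.
- by move=> n x [].
- by move=> n x [? ?]; split; auto.
have [|| N2 FN2] := noethR (F := fun n r => exists2 y, V y & F n (r *: v + y)).
- move=> n; case: (sF n) (sV) => F0 FD FZ [V0 VD VZ]; split.
  + by exists 0; rewrite // scale0r add0r.
  + move=> r s [y Vy Fy] [z Vz Fz]; exists (y + z); first exact: VD.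
    by rewrite scalerDl addrACA; apply: FD.
  + move=> r s [y Vy Fy]; exists (r *: y); first exact: VZ.
    by rewrite -scalerA -scalerDr; apply: FZ.
- by move=> n r [y Vy Fy]; exists y; auto.
exists (maxn N1 N2) => n; rewrite geq_max => /andP[N1n N2n] x Fx.
have [r [y [Vy Ex]]] := FV _ _ Fx.
have [|z Vz Fz] := FN2 n N2n r; first by exists y; rewrite // -Ex.
have Fz' := chain_le Fi (leq_maxr N1 N2) Fz.
have Fn : F n (r *: v + z) by apply: (chain_le Fi N2n).
have [|Fyz _] := FN1 n N1n (y - z).
  split; last exact: submodB.
  by have := submodB (sF n) Fx Fn; rewrite Ex opprD addrACA subrr add0r.
have -> : x = (r *: v + z) + (y - z) by rewrite Ex -addrA (addrC z) subrK.
by case: (sF (maxn N1 N2)) => _ FD _; apply: FD => //; apply: (chain_le Fi (leq_maxl _ _)).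
Qed.

Fixpoint lin (vs : seq M) (x : M) : Prop :=
  if vs is v :: vs' then exists r y, lin vs' y /\ x = r *: v + y else x = 0.

Lemma lin_submod vs : submod (lin vs).
Proof.
elim: vs => [|v vs [L0 LD LZ]] /=.
  by split=> [//|x y -> ->|r x ->]; rewrite ?addr0 ?scaler0.
split.
- by exists 0, 0; rewrite scale0r addr0.
- move=> _ _ [r [y [Ly ->]]] [s [z [Lz ->]]]; exists (r + s), (y + z).
  by split; [exact: LD | rewrite scalerDl addrACA].
- move=> q _ [r [y [Ly ->]]]; exists (q * r), (q *: y).
  by split; [exact: LZ | rewrite scalerDr scalerA].
Qed.

Lemma acc_submod_fin_gen : fin_gen M -> acc_submod (fun=> True).
Proof.
move=> [m [v vP]].
have accl vs : acc_submod (lin vs).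
  elim: vs => [|w vs IH]; last exact: acc_submod_adjoin (lin_submod vs) IH.
  move=> F sF F0 _; exists 0%N => n _ x /F0 /= ->; by case: (sF 0%N).
move=> F sF _ Fi; apply: (accl [seq v i | i <- index_enum 'I_m]) => // n x _.
have [c ->] := vP x.
elim: (index_enum _) => [|i s IH] /=; first by rewrite big_nil.
by rewrite big_cons; exists (c i), (\sum_(j <- s) c j *: v j).
Qed.

End Submodules.

(** * Graded families and the graded basis theorem *)

Section Families.
Variables (R : comPzRingType) (M : lmodType R) (D : Type).
Implicit Types (Phi : R -> (D -> D) -> Prop) (N V B : D -> M -> Prop).

Definition stable Phi N : Prop :=
  (forall d, submod (N d)) /\
  (forall a s, Phi a s -> forall d x, N d x -> N (s d) (a *: x)).

Definition acc_family Phi V : Prop :=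
  forall F : nat -> D -> M -> Prop, (forall n, stable Phi (F n)) ->
    (forall n d x, F n d x -> V d x) -> (forall n d x, F n d x -> F n.+1 d x) ->
    exists n0, forall n, (n0 <= n)%N -> forall d x, F n d x -> F n0 d x.

(** A family is read as a predicate on pairs [D * M], which brings it within the scope of
    [acc_max]. *)
Lemma acc_family_max Phi V (Q : (D -> M -> Prop) -> Prop) : acc_family Phi V ->
  (forall N, Q N -> stable Phi N /\ forall d x, N d x -> V d x) ->
  (exists N, Q N) ->
  exists2 N, Q N & forall N', Q N' -> (forall d x, N d x -> N' d x) ->
    forall d x, N' d x -> N d x.
Proof.
move=> accV QV [N0 QN0].
pose cur (A : D * M -> Prop) d x := A (d, x).
pose unc (N : D -> M -> Prop) p := N p.1 p.2.
have [||| A QA Amax] := @acc_max (D * M)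
  (fun A => stable Phi (cur A) /\ forall d x, cur A d x -> V d x) _ (fun A => Q (cur A)).
- move=> F sF Fi.
  have [||| n0 Fn0] := accV (fun n => cur (F n)).
  + by move=> n; case: (sF n).
  + by move=> n; case: (sF n).
  + by move=> n d x; apply: Fi.
  + by exists n0 => n n0n [d x]; apply: Fn0.
- by move=> A /QV.
- by exists (unc N0).
exists (cur A) => // N' QN' AN' d x Nx.
by apply: (Amax (unc N') QN' _ (d, x)) => // -[d' x'] /AN'.
Qed.

Section Adjoin.
Variables (Phi : R -> (D -> D) -> Prop) (V : D -> M -> Prop) (a : R) (s : D -> D).
Hypotheses (stV : stable Phi V) (accV : acc_family Phi V) (injs : injective s).
Hypothesis coms : forall b f, Phi b f -> forall d, f (s d) = s (f d).

Definition adjoin_op b f : Prop := Phi b f \/ (b = a /\ f = s).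

Let iterC b f k d : Phi b f -> f (iter k s d) = iter k s (f d).
Proof. by move=> Pf; elim: k => //= k IH; rewrite (coms Pf) IH. Qed.

Let inj_iter k : injective (iter k s).
Proof. by elim: k => // k IH d d' /= /injs /IH. Qed.

(** If [d] is not a [k]-fold shift, only the zero coefficient is allowed; otherwise [d'] is unique
    by injectivity of [s], which gives closure under sums. *)
Definition coef k d v : Prop := v = 0 \/ exists2 d', d = iter k s d' & V d' v.

(* Polynomials in [a] of degree less than [k] with coefficients in [V]; the
   coefficient of [a ^+ j] lives [j] shifts below [d]. *)
Fixpoint lowdeg k d x : Prop :=
  if k is k'.+1 then exists v w, [/\ coef k' d v, lowdeg k' d w & x = a ^+ k' *: v + w]
  else x = 0.

Definition adjoin d x : Prop := exists k, lowdeg k d x.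

Let coef_submod k d : submod (coef k d).
Proof.
split; first by left.
- move=> x y [->|[d1 E1 V1]]; first by rewrite add0r.
  case=> [->|[d2 E2 V2]]; first by rewrite addr0; right; exists d1.
  right; exists d1 => //; case: (stV.1 d1) => _ VD _; apply: VD => //.
  by move: V2; rewrite (_ : d2 = d1) //; apply: (@inj_iter k); rewrite -E2.
- move=> r x [->|[d1 E1 V1]]; first by rewrite scaler0; left.
  by right; exists d1 => //; case: (stV.1 d1) => _ _ VZ; apply: VZ.
Qed.

Let lowdeg_submod k d : submod (lowdeg k d).
Proof.
elim: k => [|k [L0 LD LZ]] /=.
  by split=> [//|x y -> ->|r x ->]; rewrite ?addr0 ?scaler0.
have [C0 CD CZ] := coef_submod k d; split.
- by exists 0, 0; rewrite scaler0 addr0.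
- move=> _ _ [v [w [Cv Lw ->]]] [v' [w' [Cv' Lw' ->]]]; exists (v + v'), (w + w').
  by split; [exact: CD | exact: LD | rewrite scalerDr addrACA].
- move=> r _ [v [w [Cv Lw ->]]]; exists (r *: v), (r *: w).
  by split; [exact: CZ | exact: LZ | rewrite scalerDr !scalerA mulrC].
Qed.

Let lowdeg_op b f k d x : Phi b f -> lowdeg k d x -> lowdeg k (f d) (b *: x).
Proof.
move=> Pf; elim: k x => [|k IH] x /=; first by move=> ->; rewrite scaler0.
case=> v [w [Cv Lw ->]]; exists (b *: v), (b *: w).
split; [|exact: IH|by rewrite scalerDr !scalerA mulrC].
case: Cv => [->|[d' -> Vv]]; first by left; rewrite scaler0.
by right; exists (f d'); rewrite ?(iterC _ _ Pf) //; apply: stV.2.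
Qed.

Let lowdegS k d x : lowdeg k d x -> lowdeg k.+1 d x.
Proof. by move=> Lx; exists 0, x; split=> //; [left | rewrite scaler0 add0r]. Qed.

Let lowdeg_mul k d x : lowdeg k d x -> lowdeg k.+1 (s d) (a *: x).
Proof.
elim: k x => [|k IH] x.
  move=> /= ->; exists 0, 0; split; [by left | done | by rewrite !scaler0 addr0].
case=> v [w [Cv Lw ->]]; exists v, (a *: w).
split; [|exact: IH|by rewrite scalerDr scalerA exprS].
by case: Cv => [->|[d' -> Vv]]; [left | right; exists d'].
Qed.

Lemma sub_adjoin d x : V d x -> adjoin d x.
Proof.
move=> Vx; exists 1%N, x, 0; split=> //; last by rewrite expr0 scale1r addr0.
by right; exists d.
Qed.

Lemma adjoin_stable : stable adjoin_op adjoin.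
Proof.
split=> [d|b f [Pf|[-> ->]] d x [k Lx]].
- split; first by exists 0%N.
  + move=> x y [k Lx] [l Ly]; exists (maxn k l).
    have mono := chain_le (F := fun k => lowdeg k d) (fun k => @lowdegS k d).
    case: (lowdeg_submod (maxn k l) d) => _ LD _; apply: LD.
      by apply: mono Lx; exact: leq_maxl.
    by apply: mono Ly; exact: leq_maxr.
  + by move=> r x [k Lx]; exists k; case: (lowdeg_submod k d) => _ _; apply.
- by exists k; apply: lowdeg_op.
- by exists k.+1; apply: lowdeg_mul.
Qed.

(** Leading coefficients of elements of [N], placed in the degree of the coefficient and not in that
    of the polynomial, so that for stable [N] they form a [Phi]-stable subfamily of [V]. *)
Definition lcoef k N d v : Prop :=
  V d v /\ exists2 w, lowdeg k (iter k s d) w & N (iter k s d) (a ^+ k *: v + w).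

Let lcoef_stable k N : stable adjoin_op N -> stable Phi (lcoef k N).
Proof.
move=> stN; split=> [d|b f Pf d x [Vx [w Lw Nw]]].
- have [V0 VD VZ] := stV.1 d; have [L0 LD LZ] := lowdeg_submod k (iter k s d).
  have [N0 ND NZ] := stN.1 (iter k s d); split.
  + by split=> //; exists 0; rewrite ?scaler0 ?addr0.
  + move=> x y [Vx [w Lw Nw]] [Vy [z Lz Nz]]; split; first exact: VD.
    by exists (w + z); [exact: LD | rewrite scalerDr addrACA; exact: ND].
  + move=> r x [Vx [w Lw Nw]]; split; first exact: VZ.
    exists (r *: w); first exact: LZ.
    by rewrite scalerA mulrC -scalerA -scalerDr; apply: NZ.
- split; first exact: stV.2.
  exists (b *: w); rewrite -(iterC _ _ Pf); first exact: lowdeg_op.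
  by rewrite scalerA mulrC -scalerA -scalerDr; apply: stN.2 => //; left.
Qed.

Let lcoefS k N : stable adjoin_op N -> forall d v, lcoef k N d v -> lcoef k.+1 N d v.
Proof.
move=> stN d v [Vv [w Lw Nw]]; split=> //; exists (a *: w); first exact: lowdeg_mul.
by rewrite exprS -scalerA -scalerDr; apply: (stN.2 a s) => //; right.
Qed.

Let lcoef_le k N N' : (forall d x, N d x -> N' d x) ->
  forall d v, lcoef k N d v -> lcoef k N' d v.
Proof. by move=> NN' d v [Vv [w Lw Nw]]; split=> //; exists w; auto. Qed.

(** Induction on the degree in [a]: subtracting an element of [N] with the same leading term leaves
    an element of [N'] of lower degree. *)
Let lcoef_ext N N' : stable adjoin_op N -> stable adjoin_op N' ->
  (forall d x, N d x -> N' d x) -> (forall d x, N' d x -> adjoin d x) ->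
  (forall k d v, lcoef k N' d v -> lcoef k N d v) -> forall d x, N' d x -> N d x.
Proof.
move=> stN stN' NN' N'A lcs d x N'x; have [k Lx] := N'A _ _ N'x.
elim: k x Lx N'x => [|k IH] x /=; first by move=> -> _; case: (stN.1 d).
case=> v [w [Cv Lw ->]] N'x.
case: Cv N'x => [->|[d' Ed Vv]]; first by rewrite scaler0 add0r; apply: IH.
rewrite {}Ed in Lw IH * => N'x.
have [|_ [z Lz Nz]] := lcs k d' v; first by split=> //; exists w.
rewrite (_ : _ + w = (a ^+ k *: v + z) + (w - z)); last by rewrite -addrA (addrC z) subrK.
case: (stN.1 (iter k s d')) => _ ND _; apply: ND => //; apply: IH.
  exact: submodB (lowdeg_submod _ _) _ _.
have := submodB (stN'.1 _) N'x (NN' _ _ Nz).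
by rewrite opprD addrACA subrr add0r.
Qed.

(* Hilbert's basis theorem in graded form. *)
Lemma acc_family_adjoin : acc_family adjoin_op adjoin.
Proof.
move=> F stF FA Fi.
have Fle m n : (m <= n)%N -> forall d x, F m d x -> F n d x.
  by move=> mn d; apply: (chain_le (F := fun n => F n d)) mn => k x; apply: Fi.
have lcle k l N : (k <= l)%N -> stable adjoin_op N ->
    forall d v, lcoef k N d v -> lcoef l N d v.
  by move=> kl stN d; apply: (chain_le (F := fun k => lcoef k N d)) => // *; apply: lcoefS.
(* The diagonal chain, where degree and index grow together, settles all degrees from [n0] on; the
   finitely many degrees below are settled one at a time. *)
have [||| n0 n0P] := accV (F := fun n => lcoef n (F n)).
- by move=> n; apply: lcoef_stable.
- by move=> n d x [].
- by move=> n d x lx; apply: lcoefS => //; apply: lcoef_le lx; apply: Fi.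
have small K : exists n1, forall k, (k < K)%N -> forall n, (n1 <= n)%N ->
    forall d v, lcoef k (F n) d v -> lcoef k (F n1) d v.
  elim: K => [|K [n1 n1P]]; first by exists 0%N.
  have [||| n2 n2P] := accV (F := fun n => lcoef K (F n)).
  - by move=> n; apply: lcoef_stable.
  - by move=> n d x [].
  - by move=> n d x lx; apply: lcoef_le lx; apply: Fi.
  exists (maxn n1 n2) => k; rewrite ltnS leq_eqVlt => kK n.
  rewrite geq_max => /andP[n1n n2n] d v lv; case/orP: kK => [/eqP ->|kK] in lv *.
    by apply: lcoef_le (n2P _ n2n _ _ lv); apply: Fle; rewrite leq_maxr.
  by apply: lcoef_le (n1P _ kK _ n1n _ _ lv); apply: Fle; rewrite leq_maxl.
have [n1 n1P] := small n0.
exists (maxn n0 n1) => n; rewrite geq_max => /andP[n0n n1n].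
apply: lcoef_ext (stF _) (stF n) _ (FA n) _; first by apply: Fle; rewrite geq_max n0n.
move=> k d v lv; case: (ltnP k n0) => kn0.
  by apply: lcoef_le (n1P _ kn0 _ n1n _ _ lv); apply: Fle; rewrite leq_maxr.
(* For [k] at least [n0], go up to the diagonal term [maxn k n], then down to the term [n0]. *)
apply: (lcle n0) => //; apply: (lcoef_le (N := F n0)); first by apply: Fle; rewrite leq_maxl.
apply: (n0P (maxn k n)); first by rewrite leq_max kn0.
apply: (lcle k); rewrite ?leq_maxl //.
by apply: lcoef_le lv; apply: Fle; rewrite leq_maxr.
Qed.

End Adjoin.
End Families.

(** * Generated graded families *)

Section Generated.
Variables (R : comPzRingType) (M : lmodType R) (D : Type).
Variables (Phi : R -> (D -> D) -> Prop) (B : D -> M -> Prop).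

Inductive gen : D -> M -> Prop :=
| gen_base d x : B d x -> gen d x
| gen0 d : gen d 0
| genD d x y : gen d x -> gen d y -> gen d (x + y)
| genZ d r x : gen d x -> gen d (r *: x)
| gen_op a s d x : Phi a s -> gen d x -> gen (s d) (a *: x).

Lemma gen_stable : stable Phi gen.
Proof.
by split=> [d|a s ? d x]; [split; [exact: gen0|exact: genD|exact: genZ]|exact: gen_op].
Qed.

Lemma gen_min N : stable Phi N -> (forall d x, B d x -> N d x) ->
  forall d x, gen d x -> N d x.
Proof.
move=> [sN NP] BN d x; elim=> {d x} [//|d|d x y _ Nx _ Ny|d r x _ Nx|a s d x Pas _ Nx].
- by case: (sN d).
- by case: (sN d) => _ ND _; apply: ND.
- by case: (sN d) => _ _ NZ; apply: NZ.
- exact: NP.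
Qed.

End Generated.

(** * Iterated colon modules *)

Section Colon.
Variables (R : comPzRingType) (M : lmodType R) (P : R -> Prop).

(** For a submodule [N] this is [(N :_M P^c)], unfolded one factor at a time, so that elements of
    [P^c] need not be written as sums of products. *)
Fixpoint iter_colon (N : M -> Prop) c x : Prop :=
  if c is c'.+1 then forall a, P a -> iter_colon N c' (a *: x) else N x.

Lemma iter_colon_submod N c : submod N -> submod (iter_colon N c).
Proof.
move=> sN; elim: c => //= c [C0 CD CZ]; split=> [a _|x y Cx Cy a Pa|r x Cx a Pa].
- by rewrite scaler0.
- by rewrite scalerDr; apply: CD; auto.
- by rewrite scalerA mulrC -scalerA; apply: CZ; auto.
Qed.

Lemma iter_colonM (N N' : M -> Prop) b c x : (forall x, N x -> N' (b *: x)) ->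
  iter_colon N c x -> iter_colon N' c (b *: x).
Proof.
move=> NN'; elim: c x => [|c IH] x /=; first exact: NN'.
by move=> Cx a Pa; rewrite scalerA mulrC -scalerA; apply: IH; apply: Cx.
Qed.

Lemma iter_colon_sub (N N' : M -> Prop) c x : (forall x, N x -> N' x) ->
  iter_colon N c x -> iter_colon N' c x.
Proof. by move=> NN'; elim: c x => [|c IH] x /=; [exact: NN'|move=> Cx a Pa; apply: IH; auto]. Qed.

Lemma iter_colon_le (N : M -> Prop) c c' x : submod N -> (c <= c')%N ->
  iter_colon N c x -> iter_colon N c' x.
Proof.
move=> sN cc'; apply: (chain_le (F := iter_colon N)) cc' _ => k y Cy a _.
by case: (iter_colon_submod k sN) => _ _; apply.
Qed.

End Colon.

(** * The multigraded Rees module *)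

Section Rees.
Variables (R : comPzRingType) (M : lmodType R).

Definition incr (T : eqType) (i : T) (n : T -> nat) : T -> nat :=
  fun j => (n j + (j == i))%N.

Lemma incr_inj (T : eqType) (i : T) : injective (incr i).
Proof. by move=> n m E; apply: funext => j; apply: (@addIn (j == i)); rewrite -/(incr i n j) E. Qed.

Lemma incrC (T : eqType) (i j : T) n : incr i (incr j n) = incr j (incr i n).
Proof. by apply: funext => l; rewrite /incr addnAC. Qed.

Definition rees_op (T : eqType) (I : T -> R -> Prop) (a : R)
    (s : (T -> nat) -> (T -> nat)) : Prop :=
  exists2 i, I i a & s = incr i.

(* [rees I n] is [I_1^{n_1} ... I_t^{n_t} M]. *)
Definition rees (T : eqType) (I : T -> R -> Prop) : (T -> nat) -> M -> Prop :=
  gen (rees_op I) (fun n _ => n = fun=> 0%N).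

Lemma rees_stable (T : eqType) (I : T -> R -> Prop) : stable (rees_op I) (rees I).
Proof. exact: gen_stable. Qed.

Lemma rees_submod (T : eqType) (I : T -> R -> Prop) n : submod (rees I n).
Proof. exact: (rees_stable I).1. Qed.

Lemma reesM (T : eqType) (I : T -> R -> Prop) i a n x :
  I i a -> rees I n x -> rees I (incr i n) (a *: x).
Proof. by move=> Ia; apply: (rees_stable I).2; exists i. Qed.

(** A factor from [I i] is traded for one unit of [m i] while one is left, and counts as a mere
    scalar once [m i] is 0. *)
Lemma rees_le (T : eqType) (I : T -> R -> Prop) n m x :
  (forall i, (m i <= n i)%N) -> rees I n x -> rees I m x.
Proof.
move=> mn nx; elim: nx m mn => {n x}.
- move=> n x -> m m0; apply: gen_base; apply: funext => i.
  by apply/eqP; rewrite -leqn0; apply: m0.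
- by move=> *; apply: gen0.
- by move=> n x y _ IHx _ IHy m mn; apply: genD; [exact: IHx | exact: IHy].
- by move=> n r x _ IH m mn; apply: genZ; exact: IH.
move=> a _ n x [i Ia ->] _ IH m mn.
case: (posnP (m i)) => mi.
  apply: genZ; apply: IH => j; have := mn j; rewrite /incr.
  by case: eqP => [->|_]; rewrite ?mi ?addn0.
pose m' j := (m j - (j == i))%N.
have -> : m = incr i m'.
  by apply: funext => j; rewrite /incr /m' subnK //; case: eqP => [->|].
by apply: reesM => //; apply: IH => j; rewrite /m' leq_subLR addnC mn.
Qed.

Lemma rees_incr_le (T : eqType) (I : T -> R -> Prop) i n x :
  rees I (incr i n) x -> rees I n x.
Proof. by apply: rees_le => j; apply: leq_addr. Qed.

(** Each [I i] is finitely generated, so finitely many operators suffice; the basis theorem is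
    applied once for each, starting from [M] placed in degree 0. *)
Lemma rees_acc (T : finType) (I : T -> R -> Prop) : noetherian R -> fin_gen M ->
  (forall i, is_ideal (I i)) -> acc_family (rees_op I) (rees I).
Proof.
move=> noethR fgM idI.
pose ops (gs : seq (R * T)) a (s : (T -> nat) -> T -> nat) :=
  exists2 i, (a, i) \in gs & s = incr i.
have main gs : exists V : (T -> nat) -> M -> Prop,
    [/\ stable (ops gs) V, acc_family (ops gs) V & forall x, V (fun=> 0%N) x].
  elim: gs => [|[a i] gs [V [stV accV V0]]].
    exists (fun n x => n = (fun=> 0%N) \/ x = 0); split; last by left.
      split=> [n|a s [i]//]; split; first by right.
      + by move=> x y [->|->]; [left | rewrite add0r].
      + by move=> r x [->|->]; [left | rewrite scaler0; right].
    move=> F stF F0 Fi.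
    have [|||n0 Fn0] := acc_submod_fin_gen noethR fgM (F := fun n => F n (fun=> 0%N)) => //.
    - by move=> n; apply: (stF n).1.
    - by move=> n x; apply: Fi.
    exists n0 => n n0n d x Fx; have [E|->] := F0 _ _ _ Fx.
      by move: Fx; rewrite E; exact: Fn0.
    by case: ((stF n0).1 d).
  have comb b f : ops gs b f -> forall d, f (incr i d) = incr i (f d).
    by case=> j _ -> d; apply: incrC.
  exists (adjoin V a (incr i)).
  have opsE : ops ((a, i) :: gs) = adjoin_op (ops gs) a (incr i).
    apply: funext => b; apply: funext => f; apply: propext; split.
      case=> j; rewrite inE => /orP[/eqP[-> ->] ->|gj ->]; first by right.
      by left; exists j.
    case=> [[j gj ->]|[-> ->]]; [exists j|exists i] => //; rewrite inE ?eqxx //.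
    by rewrite gj orbT.
  rewrite opsE; split.
  - exact: (adjoin_stable a stV (@incr_inj _ i) comb).
  - exact: (acc_family_adjoin stV accV (@incr_inj _ i) comb).
  - by move=> x; apply: sub_adjoin.
have fgI i : exists s : seq R, (forall a, a \in s -> I i a) /\
    forall N, is_ideal N -> (forall a, a \in s -> N a) -> forall a, I i a -> N a.
  by have [s ? ?] := ideal_fg noethR (idI i); exists s.
have [S SP] := choice fgI.
pose gs := [seq (a, i) | i <- enum T, a <- S i].
have gsP a i : ((a, i) \in gs) <-> (a \in S i).
  split=> [/allpairsPdep[j [b [_ ? [-> ->]]]] //|aS].
  by apply/allpairsPdep; exists i, a; rewrite mem_enum.
have [V [stV accV V0]] := main gs.
(* The multipliers that preserve [V] in direction [i] form an ideal, so testing the generators [S i]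
   is enough. *)
have stVI : stable (rees_op I) V.
  split=> [|a _ [i Ia ->] n x]; first exact: stV.1.
  move: a Ia n x; apply: (SP i).2.
    split=> [n x _|a b Na Nb n x Vx|r a Na n x Vx].
    - by rewrite scale0r; case: (stV.1 (incr i n)).
    - by rewrite scalerDl; case: (stV.1 (incr i n)) => _ VD _; apply: VD; auto.
    - by rewrite -scalerA; case: (stV.1 (incr i n)) => _ _ VZ; apply: VZ; auto.
  by move=> a aS n x; apply: stV.2; exists i => //; apply/gsP.
move=> F stF FI Fi; apply: accV => // [n|n d x /FI].
  split=> [|a _ [i /gsP aS ->]]; first exact: (stF n).1.
  by apply: (stF n).2; exists i => //; apply: (SP i).1.
by apply: gen_min => // {}d {}x ->.
Qed.

End Rees.

(** * The Artin-Rees argument for saturations *)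

Section ArtinRees.
Variables (R : comPzRingType) (M : lmodType R) (T : finType) (I : T -> R -> Prop).
Hypotheses (noethR : noetherian R) (fgM : fin_gen M) (idI : forall i, is_ideal (I i)).
Variables (p i : T).

Definition set_deg (m : T -> nat) l : T -> nat := fun j => if j == p then l else m j.

Let set_deg_incr m l : set_deg (incr p m) l = set_deg m l.
Proof. by apply: funext => j; rewrite /set_deg /incr; case: eqP => //; rewrite addn0. Qed.

Let set_deg_incr_neq j m l : j != p -> set_deg (incr j m) l = incr j (set_deg m l).
Proof.
move=> jp; apply: funext => q; rewrite /set_deg /incr; case: eqP => // ->.
by rewrite eq_sym (negPf jp) addn0.
Qed.

Let incr_set_deg m l : incr p (set_deg m l) = set_deg m l.+1.
Proof. by apply: funext => j; rewrite /set_deg /incr; case: eqP => _; rewrite ?addn1 ?addn0. Qed.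

(** Coordinate [p] counts factors from [I p]: the number recorded in [m] is replaced by [l] before
    direction [i] is added. *)
Let target m l : M -> Prop := rees I (incr i (set_deg m l)).

Let colon_op c j b m l x : I j b -> j != p ->
  iter_colon (I p) (target m l) c x -> iter_colon (I p) (target (incr j m) l) c (b *: x).
Proof.
move=> Ib jp; apply: iter_colonM => y; rewrite /target set_deg_incr_neq // incrC.
exact: reesM.
Qed.

(** An operator from [I p] does not change [target m 0], whose degree ignores [m p]; the other
    operators shift it along with [m]. *)
Let colon_stable c : stable (rees_op I)
  (fun m x => rees I m x /\ iter_colon (I p) (target m 0) c x).
Proof.
split=> [m|b _ [j Ib ->] m x [mx cx]].
  have [E0 ED EZ] := @rees_submod _ M _ I m.
  have [C0 CD CZ] := @iter_colon_submod _ _ (I p) _ c (@rees_submod _ M _ I (incr i (set_deg m 0))).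
  by split=> // [x y [? ?] [? ?]|r x [? ?]]; split; auto.
split; first exact: reesM.
have [->|jp] := eqVneq j p; last exact: colon_op.
rewrite /target set_deg_incr.
have sub := @rees_submod _ M _ I (incr i (set_deg m 0)).
by have [_ _ CZ] := iter_colon_submod (I p) c sub; apply: CZ.
Qed.

(* With [P = I p], a homogeneous generator in [P]-degree at most [d] is mapped into
   [target] by [P^c], so each factor from [P] beyond the first [d + c] survives. *)
Lemma artin_rees_saturation : exists k, forall m l (x : M), m p = (l + k)%N -> rees I m x ->
  (exists c, iter_colon (I p) (rees I (incr i (set_deg m 0))) c x) ->
  rees I (incr i (set_deg m l)) x.
Proof.
have acc := rees_acc noethR fgM idI.
have colS c m x : iter_colon (I p) (target m 0) c x -> iter_colon (I p) (target m 0) c.+1 x.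
  by apply: iter_colon_le => //; apply: rees_submod.
(* The saturation is exhausted by a chain of stable families, so one exponent [c] serves in all
   degrees. *)
have [||| c cP] := acc (fun c m x => rees I m x /\ iter_colon (I p) (target m 0) c x).
- exact: colon_stable.
- by move=> c m x [].
- by move=> c m x [? ?]; split=> //; apply: colS.
pose H m x := rees I m x /\ iter_colon (I p) (target m 0) c x.
(* The chain [G] becomes stationary, so the part of [H] in bounded [p]-degree generates all of
   [H]. *)
pose G d := gen (rees_op I) (fun m x => H m x /\ (m p <= d)%N).
have [||| d dP] := acc G.
- by move=> d; apply: gen_stable.
- by move=> d; apply: gen_min; [exact: rees_stable | move=> m x [[]]].
- move=> d; apply: gen_min; first exact: gen_stable.
  by move=> m x [Hx md]; apply: gen_base; split=> //; apply: leqW.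
(* Truncated subtraction merges two regimes: up to [p]-degree [d + c] a factor from [I p] uses up
   one colon step; beyond it, the factor is kept in [target]. *)
have GP m x : G d m x ->
    iter_colon (I p) (target m (m p - (d + c))%N) (d + c - m p)%N x.
  move: m x; apply: (gen_min (N := fun m x =>
    iter_colon (I p) (target m (m p - (d + c))%N) (d + c - m p)%N x)); last first.
    move=> m x [[_ cx] md].
    have -> : (m p - (d + c) = 0)%N by apply/eqP; rewrite subn_eq0 (leq_trans md) ?leq_addr.
    by apply: iter_colon_le cx; [exact: rees_submod | rewrite addnC -addnBA // leq_addr].
  split=> [m|b _ [j Ib ->] m x].
    by apply: iter_colon_submod; apply: rees_submod.
  have [Ej|jp] := eqVneq j p; last first.
    have -> : incr j m p = m p by rewrite /incr eq_sym (negPf jp) addn0.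
    exact: colon_op.
  rewrite {}Ej in Ib *; have Ep : incr p m p = (m p).+1 by rewrite /incr eqxx addn1.
  rewrite /target set_deg_incr Ep.
  case: (ltnP (m p) (d + c)) => md.
    rewrite (_ : d + c - m p = (d + c - (m p).+1).+1)%N; last by rewrite subnSK.
    have /eqP -> : (m p - (d + c) == 0)%N by rewrite subn_eq0 ltnW.
    have /eqP -> : ((m p).+1 - (d + c) == 0)%N by rewrite subn_eq0.
    exact.
  have /eqP -> : (d + c - m p == 0)%N by rewrite subn_eq0.
  have /eqP -> : (d + c - (m p).+1 == 0)%N by rewrite subn_eq0 leqW.
  by rewrite subSn //= -incr_set_deg incrC; apply: reesM.
exists (d + c)%N => m l x mp mx [c' cx].
have Hx : H m x.
  apply: (cP (maxn c c')); first exact: leq_maxl.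
  by split=> //; apply: iter_colon_le cx; [exact: rees_submod | exact: leq_maxr].
have Gx : G d m x.
  apply: (dP (maxn d (m p))); first exact: leq_maxl.
  by apply: gen_base; split=> //; exact: leq_maxr.
have := GP m x Gx; rewrite mp addnK.
by have /eqP -> : (d + c - (l + (d + c)) == 0)%N by rewrite subn_eq0 leq_addl.
Qed.

End ArtinRees.

(** * Finiteness of associated primes *)

Section AssociatedPrimes.
Variables (R : comPzRingType) (M : lmodType R) (D : Type).
Variables (Phi : R -> (D -> D) -> Prop) (V : D -> M -> Prop).
Hypotheses (noethR : noetherian R) (stV : stable Phi V) (accV : acc_family Phi V).

Definition is_prime (P : R -> Prop) : Prop :=
  ~ P 1 /\ forall a b, P (a * b) -> P a \/ P b.

(* This encodes the finiteness of the set of primes that are annihilators of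
   homogeneous elements of [V / L]: any bound that exists for each ideal can be
   chosen uniformly on that set.  Adding to [L] an element whose annihilator is
   maximal contributes a single new ideal. *)
Lemma bounded_on_ass (K : (R -> Prop) -> nat -> Prop) (L : D -> M -> Prop) :
  (forall P k l, (k <= l)%N -> K P k -> K P l) ->
  (forall P, is_ideal P -> exists k, K P k) ->
  stable Phi L -> (forall d x, L d x -> V d x) ->
  exists k, forall d y, V d y -> is_prime (fun r => L d (r *: y)) ->
    K (fun r => L d (r *: y)) k.
Proof.
move=> Kmono Kex stL0 L0V; apply: contrapT => bad0.
pose bounded (L : D -> M -> Prop) := exists k, forall d y, V d y ->
  is_prime (fun r => L d (r *: y)) -> K (fun r => L d (r *: y)) k.
have [||{stL0 L0V bad0}L [stL LV bad] Lmax] := acc_family_max accV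
  (Q := fun L => [/\ stable Phi L, forall d x, L d x -> V d x & ~ bounded L]).
- by move=> N [].
- by exists L.
apply: bad.
(* If [L] is all of [V], every annihilator contains 1 and none is prime. *)
have [[n0 [x0 [Vx0 Lx0]]]|noLx] := pselect (exists n x, V n x /\ ~ L n x); last first.
  exists 0%N => d y Vy [nP1 _]; case: nP1; rewrite scale1r.
  by apply: contrapT => nL; apply: noLx; exists d, y.
(* Maximality of [A] will force every homogeneous element of [L'] outside [L] to have annihilator
   [A] modulo [L]. *)
have [|| A [n [x [Vx Lx EA]]] Amax] := @acc_max R (@is_ideal R) noethR
  (fun A => exists n x, [/\ V n x, ~ L n x & A = fun r => L n (r *: x)]).
- by move=> _ [n [x [_ _ ->]]]; apply: is_ideal_transporter; apply: stL.1.
- by exists (fun r => L n0 (r *: x0)), n0, x0.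
have idA : is_ideal A by rewrite EA; apply: is_ideal_transporter; apply: stL.1.
pose L' := gen Phi (fun m z => L m z \/ (m = n /\ z = x)).
have stL' : stable Phi L' by apply: gen_stable.
have L'V d z : L' d z -> V d z.
  by apply: gen_min => // m w [/LV//|[-> ->]].
have LL' d z : L d z -> L' d z by move=> Lz; apply: gen_base; left.
have [k' k'P] : bounded L'.
  apply: contrapT => bad; apply: Lx; apply: (Lmax L') => //.
  by apply: gen_base; right.
(* Operators move [x] to multiples [s *: x] in other degrees [d], so the inclusion of [A] in the new
   annihilator has to be carried along. *)
have L'P d z : L' d z -> exists l s, [/\ L d l, z = l + s *: x, V d (s *: x) &
    forall r, L n (r *: x) -> L d (r *: (s *: x))].
  move: d z; apply: (gen_min (N := fun d z => exists l s, [/\ L d l, z = l + s *: x,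
    V d (s *: x) & forall r, L n (r *: x) -> L d (r *: (s *: x))])); last first.
    move=> d z [Lz|[-> ->]].
      exists z, 0; rewrite scale0r addr0; split=> // [|r _]; first by case: (stV.1 d).
      by rewrite scaler0; case: (stL.1 d).
    by exists 0, 1; rewrite scale1r add0r; split=> //; case: (stL.1 n).
  split=> [d|a f Pf d _ [l [s [Ll -> Vs sP]]]].
    have [L0 LD LZ] := stL.1 d; have [V0 VD VZ] := stV.1 d; split.
    + by exists 0, 0; rewrite scale0r addr0; split=> // r _; rewrite scaler0.
    + move=> _ _ [l [s [Ll -> Vs sP]]] [l' [s' [Ll' -> Vs' sP']]].
      exists (l + l'), (s + s'); rewrite scalerDl addrACA; split; auto=> r Lr.
      by rewrite scalerDr; auto.
    + move=> q _ [l [s [Ll -> Vs sP]]]; exists (q *: l), (q * s).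
      rewrite scalerDr -scalerA; split; auto=> r Lr.
      by rewrite scalerA mulrC -scalerA; auto.
  exists (a *: l), (a * s); rewrite scalerDr -scalerA; split=> //.
  - exact: stL.2.
  - exact: stV.2.
  - by move=> r Lr; rewrite scalerA mulrC -scalerA; apply: stL.2 => //; apply: sP.
have [kA KA] := Kex A idA.
exists (maxn k' kA) => d y Vy Ppr.
(* If a multiple [r *: y] lies in [L'] but not in [L], its annihilator is [A] and, by primality,
   also that of [y]. Otherwise [y] has the same annihilator modulo [L] and [L'], and [k']
   applies. *)
have [[r [L'r Lr]]|noL'] := pselect (exists r, L' d (r *: y) /\ ~ L d (r *: y)).
  have [l [s [Ll Er Vs sP]]] := L'P _ _ L'r.
  have sub_l q : L d (q *: (r *: y)) <-> L d (q *: (s *: x)).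
    have [_ LD LZ] := stL.1 d; rewrite Er scalerDr.
    split=> [Lq|]; last by move=> ?; apply: LD => //; apply: LZ.
    by have := submodB (stL.1 d) Lq (LZ q _ Ll); rewrite addrAC subrr add0r.
  have -> : (fun r => L d (r *: y)) = A.
    apply: funext => q; apply: propext; split=> [Lq|].
      apply: (Amax (fun q => L d (q *: (s *: x)))).
      + exists d, (s *: x); split=> // Ls; apply: Lr.
        by rewrite -[r *: y]scale1r; apply/sub_l; rewrite scale1r.
      + by rewrite EA.
      + by apply/sub_l; rewrite scalerA mulrC -scalerA; case: (stL.1 d) => _ _; apply.
    rewrite EA => /sP /sub_l; rewrite scalerA => Lqr.
    by case: (Ppr.2 _ _ Lqr).
  by apply: Kmono KA; exact: leq_maxr.
have E : (fun r => L d (r *: y)) = (fun r => L' d (r *: y)).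
  apply: funext => q; apply: propext; split; first exact: LL'.
  by move=> L'q; apply: contrapT => nL; apply: noL'; exists q.
by rewrite E in Ppr *; apply: Kmono (k'P _ _ Vy Ppr); exact: leq_maxl.
Qed.

End AssociatedPrimes.

(** * Adjoining an ideal [P] to the family, and Artin-Rees bounds *)

Lemma finite_uniform (T : finType) (Q : T -> nat -> Prop) :
  (forall i k l, (k <= l)%N -> Q i k -> Q i l) ->
  (forall i, exists k, Q i k) -> exists k, forall i, Q i k.
Proof.
move=> Qm /choice[f fP]; exists (\max_i f i)%N => i.
by apply: Qm (fP i); apply: leq_bigmax.
Qed.

Section AddIdeal.
Variables (R : comPzRingType) (M : lmodType R) (T : finType) (I : T -> R -> Prop).
Variable P : R -> Prop.

(** With [P] indexed by [None], [rees ext_ideals (ext_deg l n)] is [P^l I^n M]. *)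
Definition ext_ideals (o : option T) : R -> Prop := if o is Some i then I i else P.
Definition ext_deg l (n : T -> nat) (o : option T) : nat := if o is Some i then n i else l.

Lemma incr_ext_deg i l n : incr (Some i) (ext_deg l n) = ext_deg l (incr i n).
Proof. by apply: funext => -[j|]; rewrite /incr //= addn0. Qed.

Lemma rees_ext n (x : M) : rees I n x -> rees ext_ideals (ext_deg 0 n) x.
Proof.
apply: (gen_min (N := fun n => rees ext_ideals (ext_deg 0 n))) => [|m y ->]; last first.
  by apply: gen_base; apply: funext => -[].
split=> [m|a _ [i Ia ->] m y]; first exact: rees_submod.
by rewrite -incr_ext_deg; apply: reesM.
Qed.

(** Minimality of [gen] needs a family in all degrees: the claim is made vacuous where the [None]
    coordinate is positive, which is where operators from [P] lead. *)
Lemma ext_rees n (x : M) : rees ext_ideals (ext_deg 0 n) x -> rees I n x.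
Proof.
pose N (m : option T -> nat) (y : M) := m None = 0%N -> rees I (m \o Some) y.
move=> nx; suff /(_ erefl) : N (ext_deg 0 n) x by [].
apply: gen_min nx => [|m y -> _]; last exact: gen_base.
split=> [m|a _ [o Ia ->] m y Ny].
  have [E0 ED EZ] := @rees_submod _ M _ I (m \o Some).
  by split=> [//|y z Ny Nz E|r y Ny E]; auto.
case: o Ia => [i|] Ia; rewrite /N /incr /=; last by rewrite addn1.
by rewrite addn0 => m0; apply: (reesM (i := i) Ia); apply: Ny.
Qed.

Definition ar_bound i k : Prop := forall n l (x : M),
  rees ext_ideals (ext_deg (l + k) n) x ->
  (exists c, iter_colon P (rees I (incr i n)) c x) ->
  rees ext_ideals (ext_deg l (incr i n)) x.

Lemma ar_bound_le i k k' : (k <= k')%N -> ar_bound i k -> ar_bound i k'.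
Proof.
move=> kk' ark n l x nx; apply: ark; apply: rees_le nx => -[j|] //=.
by rewrite leq_add2l.
Qed.

Lemma ar_bound_ex : noetherian R -> fin_gen M -> (forall i, is_ideal (I i)) ->
  is_ideal P -> exists k, forall i, ar_bound i k.
Proof.
move=> noethR fgM idI idP; apply: finite_uniform ar_bound_le _ => i.
have idE o : is_ideal (ext_ideals o) by case: o.
have [k kP] := @artin_rees_saturation R M _ ext_ideals noethR fgM idE None (Some i).
exists k => n l x nx [c cx].
have set_degE a b : set_deg None (ext_deg a n) b = ext_deg b n by apply: funext => -[].
have := kP _ l x erefl nx; rewrite !set_degE !incr_ext_deg; apply.
by exists c; apply: iter_colon_sub cx => y; apply: rees_ext.
Qed.

End AddIdeal.

(** * Products of ideals and the Rees components *)

Section Products.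
Variables (R : comPzRingType) (M : lmodType R).

Lemma submod_sum (N : M -> Prop) m (f : 'I_m -> M) : submod N ->
  (forall i, N (f i)) -> N (\sum_(i < m) f i).
Proof. by case=> N0 ND _ Nf; apply: big_ind. Qed.

Lemma idealMul_scale (A B : R -> Prop) (N : M -> Prop) a x : submod N ->
  (forall b c, A b -> B c -> N (b *: (c *: x))) -> idealMul A B a -> N (a *: x).
Proof.
move=> sN ABN [m [b [c [bc ->]]]]; rewrite scaler_suml; apply: submod_sum => // i.
by rewrite -scalerA; apply: ABN; case: (bc i).
Qed.

Lemma idealX_sub (J P : R -> Prop) n a : (forall b, J b -> P b) ->
  idealX J n a -> idealX P n a.
Proof.
move=> JP; elim: n a => // n IH a [m [b [c [bc ->]]]]; exists m, b, c; split=> // i.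
by case: (bc i) => ? ?; split; [exact: JP | exact: IH].
Qed.

Lemma idealX_exp (J : R -> Prop) n a : J a -> idealX J n (a ^+ n).
Proof.
move=> Ja; elim: n => // n IH; exists 1%N, (fun=> a), (fun=> a ^+ n).
by split=> //; rewrite big_ord1 exprS.
Qed.

Lemma modMul_submod (A : R -> Prop) : submod (@modMul R M A).
Proof.
split.
- by exists 0%N, (fun=> 0), (fun=> 0); rewrite big_ord0; split=> // -[].
- move=> _ _ [m [a [v [Aa ->]]]] [m' [a' [v' [Aa' ->]]]].
  exists (m + m')%N, (fun k => match split k with inl i => a i | inr j => a' j end).
  exists (fun k => match split k with inl i => v i | inr j => v' j end).
  split=> [k|]; first by case: (split k).
  rewrite big_split_ord /=; congr (_ + _); apply: eq_bigr => i _.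
    by rewrite (unsplitK (inl i)).
  by rewrite (unsplitK (inr i)).
- move=> r _ [m [a [v [Aa ->]]]]; exists m, a, (fun i => r *: v i); split=> //.
  by rewrite scaler_sumr; apply: eq_bigr => i _; rewrite !scalerA mulrC.
Qed.

Lemma iter_incr (T : eqType) (i : T) c m j : iter c (incr i) m j = (m j + c * (j == i))%N.
Proof. by elim: c => [|c IH]; rewrite ?addn0 //= {1}/incr IH mulSnr addnA. Qed.

Lemma rees_idealX (T : eqType) (I : T -> R -> Prop) i c n a (x : M) :
  idealX (I i) c a -> rees I n x -> rees I (iter c (incr i) n) (a *: x).
Proof.
elim: c a => [|c IH] a; first by move=> _ nx; apply: genZ.
move=> Xa nx; apply: idealMul_scale Xa; first exact: rees_submod.
by move=> b d Ib Xd; rewrite iterS; apply: reesM => //; apply: IH.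
Qed.

(** An arbitrary list replaces the enumeration in [idealProdPow], to allow induction. *)
Definition prod_on (t : nat) (I : 'I_t -> R -> Prop) (n : 'I_t -> nat) (l : seq 'I_t) :=
  foldr (fun i acc => idealMul (idealX (I i) (n i)) acc) (fun=> True) l.

Lemma prod_on_eq t (I : 'I_t -> R -> Prop) n n' l :
  (forall i, i \in l -> n i = n' i) -> prod_on I n l = prod_on I n' l.
Proof.
elim: l => //= i l IH nn'; rewrite IH; last by move=> j jl; rewrite nn' // inE jl orbT.
by rewrite nn' // inE eqxx.
Qed.

Lemma idealX_mul (I : R -> Prop) c a b : I a -> idealX I c b -> idealX I c.+1 (a * b).
Proof. by move=> Ia Xb; exists 1%N, (fun=> a), (fun=> b); rewrite big_ord1. Qed.

(** As [l] has no repetition, exactly one power absorbs [a], and [incr i] leaves the others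
    unchanged. *)
Lemma prod_on_incr t (I : 'I_t -> R -> Prop) n l i a b : uniq l -> i \in l ->
  I i a -> prod_on I n l b -> prod_on I (incr i n) l (a * b).
Proof.
move=> + + Ia; elim: l b => //= j l IH b /andP[jl ul]; rewrite inE.
have [Eij _|ij /= il] := eqVneq i j; case=> m [f [g [fg ->]]].
  rewrite -{}Eij in jl fg *; exists m, (fun k => a * f k), g; split; last first.
    by rewrite mulr_sumr; apply: eq_bigr => k _; rewrite mulrA.
  move=> k; case: (fg k) => Xf Pg; split.
    by rewrite /incr eqxx addn1; apply: idealX_mul.
  rewrite -/(prod_on I (incr i n) l) (@prod_on_eq t I _ n) // => q ql.
  by rewrite /incr; case: eqP ql => [->|_ _]; rewrite ?(negPf jl) ?addn0.
exists m, f, (fun k => a * g k); split; last first.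
  by rewrite mulr_sumr; apply: eq_bigr => k _; rewrite mulrCA.
move=> k; case: (fg k) => Xf Pg; split; last exact: IH.
by rewrite /incr eq_sym (negPf ij) addn0.
Qed.

Lemma modMul_rees t (I : 'I_t -> R -> Prop) n (x : M) :
  modMul (idealProdPow I n) x -> rees I n x.
Proof.
case=> m [a [v [Pa ->]]]; apply: submod_sum; first exact: rees_submod.
move=> k; move: (a k) (v k) (Pa k) => b y Pb.
(* The part of [n] supported on the list: the degree must shrink with the list in the induction
   below. *)
pose sh := foldr (fun i acc => iter (n i) (incr i) acc) (fun=> 0%N).
have shE l j : uniq l -> sh l j = if j \in l then n j else 0%N.
  elim: l => //= i l IH /andP[il ul]; rewrite iter_incr IH // inE.
  by case: eqVneq => [->|_]; rewrite ?(negPf il) ?muln1 ?muln0 ?addn0.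
have -> : n = sh (enum 'I_t).
  by apply: funext => j; rewrite shE ?enum_uniq // mem_enum.
rewrite /idealProdPow in Pb; elim: (enum _) b Pb => [|i l IH] b Pb.
  by apply: gen_base.
apply: idealMul_scale Pb; first exact: rees_submod.
by move=> c d Xc Pd; apply: rees_idealX => //; apply: IH.
Qed.

Lemma rees_modMul t (I : 'I_t -> R -> Prop) n (x : M) :
  rees I n x -> modMul (idealProdPow I n) x.
Proof.
move: n x; apply: (gen_min (N := fun n => modMul (idealProdPow I n))).
  split=> [n|a _ [i Ia ->] n _ [m [b [v [Pb ->]]]]]; first exact: modMul_submod.
  exists m, (fun k => a * b k), v; split; last first.
    by rewrite scaler_sumr; apply: eq_bigr => k _; rewrite scalerA.
  by move=> k; apply: prod_on_incr (Pb k); rewrite ?enum_uniq ?mem_enum.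
move=> n x ->; exists 1%N, (fun=> 1), (fun=> x); rewrite big_ord1 scale1r; split=> // _.
rewrite /idealProdPow; elim: (enum _) => //= i l IH.
by exists 1%N, (fun=> 1), (fun=> 1); rewrite big_ord1 mulr1.
Qed.

Lemma modMul_idealX_rees (T : finType) (I : T -> R -> Prop) (J P : R -> Prop) k (x : M) :
  (forall a, J a -> P a) -> modMul (idealX J k) x ->
  rees (ext_ideals I P) (ext_deg k (fun=> 0%N)) x.
Proof.
move=> JP [m [a [v [Xa ->]]]]; apply: submod_sum; first exact: rees_submod.
move=> j; have -> : ext_deg k (fun=> 0%N) = iter k (incr None) (fun _ : option T => 0%N).
  by apply: funext => -[i|]; rewrite iter_incr //= ?muln0 ?muln1.
apply: rees_idealX; last exact: gen_base.
by apply: idealX_sub (Xa j).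
Qed.

End Products.

(** * Unit steps from 0 to [n] *)

Section Climb.
Variables (t : nat) (n : 'I_t -> nat) (Q : ('I_t -> nat) -> Prop).

Definition deg_sum (m : 'I_t -> nat) : nat := (\sum_(i < t) m i)%N.

Lemma deg_sum_incr i m : deg_sum (incr i m) = (deg_sum m).+1.
Proof.
rewrite /deg_sum /incr big_split /= -addn1; congr (_ + _)%N.
by rewrite (bigD1 i) //= eqxx big1 // => j /negPf ->.
Qed.

Lemma deg_sum_le (m m' : 'I_t -> nat) :
  (forall j, (m j <= m' j)%N) -> (deg_sum m <= deg_sum m')%N.
Proof. by move=> mm'; apply: leq_sum => j _. Qed.

Lemma incr_le m i : (forall j, (m j <= n j)%N) -> (m i < n i)%N ->
  forall j, (incr i m j <= n j)%N.
Proof. by move=> mn mi j; rewrite /incr; case: eqP => [->|_]; rewrite ?addn1 ?addn0. Qed.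

(** It serves twice: to locate a quotient to which a prime is associated, and to trade powers of
    that prime for factors of [I^n]. *)
Lemma climb : Q (fun=> 0%N) ->
  (forall m i, (forall j, (m j <= n j)%N) -> (m i < n i)%N -> Q m -> Q (incr i m)) -> Q n.
Proof.
move=> Q0 Qi.
have eqmn m : ~ (exists i, (m i < n i)%N) -> (forall j, (m j <= n j)%N) -> m = n.
  move=> no mn; apply: funext => j; apply/eqP; rewrite eqn_leq mn leqNgt.
  by apply/negP => mj; apply: no; exists j.
(* [k] bounds the number of unit steps that remain. *)
suff H k m : (forall j, (m j <= n j)%N) -> Q m -> (deg_sum n <= deg_sum m + k)%N -> Q n.
  by apply: (H (deg_sum n) (fun=> 0%N)) => //; apply: leq_addl.
elim: k m => [|k IH] m mn Qm dk;
  have [[i mi]|/eqmn/(_ mn)<-//] := pselect (exists i, (m i < n i)%N).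
- have := deg_sum_le (incr_le mn mi); rewrite deg_sum_incr.
  by move=> /leq_trans/(_ dk); rewrite addn0 ltnn.
- by apply: (IH (incr i m)); [exact: incr_le | exact: Qi | rewrite deg_sum_incr addSnnS].
Qed.

End Climb.

(** * Passage to an associated prime and conclusion *)

Theorem theorem3p3 (R : comPzRingType) (M : lmodType R) (t : nat)
  (I : 'I_t -> R -> Prop) :
  noetherian R -> fin_gen M -> (forall i, is_ideal (I i)) ->
  exists k : nat, forall (n : 'I_t -> nat) (J : R -> Prop), is_ideal J ->
    forall x : M,
      modMul (idealX J (k * \sum_(i < t) n i)%N) x ->
      colon_inf (modMul (idealProdPow I n)) J x ->
      modMul (idealProdPow I n) x.
Proof.
move=> noethR fgM idI.
pose K P k := forall i, @ar_bound R M _ I P i k.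
have Kmono P k l : (k <= l)%N -> K P k -> K P l.
  by move=> kl KP i; apply: ar_bound_le (KP i).
have Kex P : is_ideal P -> exists k, K P k by apply: ar_bound_ex.
(* One [k] for all primes associated to some [I^m M / I^(m+e_i) M], in every direction [i]. *)
have [||k kP] := @finite_uniform _ (fun i k => forall m (y : M), rees I m y ->
    is_prime (fun r => rees I (incr i m) (r *: y)) ->
    K (fun r => rees I (incr i m) (r *: y)) k).
- by move=> i k l kl kP m y my pr; apply: Kmono (kP _ _ my pr).
- move=> i.
  apply: (@bounded_on_ass _ _ _ (rees_op I) (rees I) noethR _ _ K
    (fun m => rees I (incr i m))) => //.
  + exact: rees_stable.
  + exact: rees_acc.
  + split=> [m|a _ [j Ia ->] m y]; first exact: rees_submod.
    by rewrite incrC; apply: reesM.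
  + by move=> m y; apply: rees_incr_le.
exists k => n J _ x Jx [c cx]; apply: rees_modMul; apply: contrapT => nx.
have sn := @rees_submod _ M _ I n.
have [_ _ snZ] := sn.
(* A maximal annihilator among the multiples of [x] outside [I^n M] will be prime. *)
have [|| P [r [nrx EP]] Pmax] := @acc_max R (@is_ideal R) noethR
  (fun P => exists r, ~ rees I n (r *: x) /\ P = fun q => rees I n (q *: (r *: x))).
- by move=> _ [r [_ ->]]; apply: is_ideal_transporter.
- by exists (fun q => rees I n (q *: (1 *: x))), 1; rewrite scale1r.
pose y := r *: x; rewrite -/y in nrx EP.
have PE q : P q = rees I n (q *: y) by rewrite EP.
have idP : is_ideal P by rewrite EP; apply: is_ideal_transporter.
have annE s : ~ rees I n (s *: y) -> forall q, rees I n (q *: (s *: y)) -> P q.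
  move=> ns; apply: (Pmax (fun q => rees I n (q *: (s *: y)))).
    by exists (s * r); rewrite -scalerA.
  by move=> q; rewrite PE => nq; rewrite scalerA mulrC -scalerA; apply: snZ.
have prP : is_prime P.
  split=> [|a b]; first by rewrite PE scale1r.
  rewrite !PE -scalerA => nab.
  have [nb|nb] := pselect (rees I n (b *: y)); first by right.
  by left; rewrite -PE; apply: annE nab.
have JP a : J a -> P a.
  move=> Ja; have : P (a ^+ c).
    rewrite PE /y scalerA mulrC -scalerA; apply: snZ; apply: modMul_rees.
    by apply: cx; apply: idealX_exp.
  elim: (c) => [/prP.1//|d IH]; rewrite exprS => /prP.2[//|]; exact: IH.
have KP : K P k.
  suff [i [m [s [ms Em]]]] : exists i m s, rees I m (s *: y) /\
      P = fun q => rees I (incr i m) (q *: (s *: y)).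
    by rewrite Em; apply: kP => //; rewrite -Em.
  (* Otherwise a climb carries a multiple of [y] outside [I^n M] through the components [I^m M] up
     to [I^n M] itself, which is absurd. *)
  apply: contrapT => no.
  suff [s [ns nns]] : exists s, rees I n (s *: y) /\ ~ rees I n (s *: y) by [].
  apply: (climb (Q := fun m => exists s, rees I m (s *: y) /\ ~ rees I n (s *: y))).
    by exists 1; rewrite scale1r; split=> //; apply: gen_base.
  move=> m i mn mi [s [ms ns]]; apply: contrapT => stop; apply: no.
  exists i, m, s; split=> //; apply: funext => q; apply: propext; split.
    rewrite PE => nq; apply: (@rees_le _ _ _ _ n); first exact: incr_le.
    by rewrite scalerA mulrC -scalerA; apply: snZ.
  (* If [q *: (s *: y)] stayed outside [I^n M] while lying in the next component, the climb could go
     on with [q * s]. *)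
  move=> iq; apply: (annE s) => //; apply: contrapT => nq; apply: stop.
  by exists (q * s); rewrite -scalerA.
apply: nrx; apply: (@ext_rees _ _ _ I P).
(* Each unit step costs [k] factors from [P], and the [k|n|] available at the start are exactly
   enough. *)
have := @climb t n (fun m =>
  rees (ext_ideals I P) (ext_deg (k * (deg_sum n - deg_sum m)) m) y).
rewrite subnn muln0; apply.
  have -> : deg_sum (fun _ : 'I_t => 0%N) = 0%N by rewrite /deg_sum big1.
  by rewrite subn0; apply: genZ; apply: modMul_idealX_rees Jx.
move=> m i mn mi my; apply: KP.
  have lt := deg_sum_le (incr_le mn mi); rewrite deg_sum_incr in lt *.
  by rewrite -mulnSr subnSK.
(* Exponent 1 suffices, since [P] maps [y] into [I^n M], which lies in [I^(m+e_i) M]. *)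
exists 1%N => a; rewrite PE /=; apply: rees_le; exact: incr_le.
Qed.
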